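(* Let $(q_k)_{k\in\mathbb N}$ be a sequence of monic polynomials $q_k\in\mathbb C[z]$ of degrees $n_k>0$ with $n_k\to\infty$, and let $\mu_k$ denote the root distribution of $q_k$. Suppose that there exists $R>0$ such that $\mu_k(\mathbb D(R))=1$ for all $k$, where $\mathbb D(R)=\{z\in\mathbb C:|z|<R\}$, and suppose that $U\subset\mathbb C$ is an open set which is root-sparse for $(q_k)_k$ and such that $V=\mathbb C\setminus U$ is convex. Then for every $m=0,1,2,\ldots$ $$\xi_{k,m}-\xi_k\to0\quad\text{on }U\text{ as }k\to\infty,$$ where $\xi_{k,m}=\xi_{q_k^{(m)}}$ and $\xi_k=\xi_{q_k}$ are the divisors on $U$ of the $m$th derivative $q_k^{(m)}$ and of $q_k$; that is, $\xi_{k,m}(\phi)-\xi_k(\phi)\to0$ as $k\to\infty$ for every $\phi\in\mathscr C_c(U)$.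
   Context: Write $q_k(z)=\prod_{j=1}^{n_k}(z-z_{k,j})$, roots repeated with multiplicity. The root-counting measure of $q_k$ is $\mu_k^\#=\sum_{j=1}^{n_k}\delta_{z_{k,j}}$, and the root distribution is the probability measure $\mu_k=\frac1{n_k}\mu_k^\#$. An open set $U\subset\mathbb C$ is root-sparse for $(q_k)_k$ if for every compact $K\subset U$ there is $M=M(K)$ with $\mu_k^\#(K)\le M$ for all sufficiently large $k$. A divisor on an open set $U$ is a map $\xi:U\to\mathbb Z$ such that $\{z:\xi(z)\ne0\}$ has no accumulation points in $U$. $\mathscr C_c(U)$ is the space of continuous functions with compact support in $U$; a divisor acts on $\phi\in\mathscr C_c(U)$ by $\xi(\phi)=\sum_z\xi(z)\phi(z)$ (a finite sum). Convergence $\xi_k\to\xi$ of divisors on $U$ means $\xi_k(\phi)\to\xi(\phi)$ for every $\phi\in\mathscr C_c(U)$. For a holomorphic function $f$ on $U$ that is not identically zero on any component of $U$, its divisor $\xi_f$ is given by $\xi_f(z)=$ the order of the zero of $f$ at $z$ (and $0$ if $f(z)\neq0$). For given $m$, $\xi_{k,m}$ is considered only for $k$ large enough that $q_k^{(m)}\not\equiv0$ (all but finitely many $k$). *)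

(* Defs.v *)
From HB Require Import structures.
From mathcomp Require Import all_boot all_order all_algebra.
From mathcomp Require Import complex.
From mathcomp Require Import all_classical all_reals all_analysis.

Set Implicit Arguments.
Unset Strict Implicit.
Unset Printing Implicit Defensive.

Import Order.TTheory GRing.Theory Num.Theory.
Import numFieldNormedType.Exports.

Local Open Scope classical_set_scope.
Local Open Scope ring_scope.
Local Open Scope complex_scope.

(* The complex numbers over the reals R.  Bundling R[i] as a
   numClosedFieldType gives it the topology of its norm. *)
Definition Cplx (R : realType) : numClosedFieldType := R[i].

Definition Cborel (R : realType) := g_sigma_algebraType (@open (Cplx R)).

Definition open_disc (R : realType) (r : R) : set (Cplx R) :=
  [set z | `|z| < r%:C].

(* Convexity is over the reals: Rcomplex R is R[i] as a real vector space. *)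
Definition convex_Cplx (R : realType) (V : set (Cplx R)) : Prop :=
  @convex_set R (Rcomplex R) V.

Section RootMeasures.
Variable R : realType.
Local Notation C := (Cplx R).
Implicit Type p : {poly C}.

Definition deg p : nat := (size p).-1.

(* The roots of p, repeated with multiplicity: for p monic,
   p = \prod_(z <- proots p) ('X - z%:P). *)
Definition proots p : seq C := sval (closed_field_poly_normal p).

Definition root_count p : {measure set (Cborel R) -> \bar R} :=
  msum (fun j => \d_((proots p)`_j : Cborel R)) (deg p).

(* Meaningful only for deg p > 0; a probability measure in that case. *)
Definition root_dist p : {measure set (Cborel R) -> \bar R} :=
  mscale ((deg p)%:R^-1)%:nng (root_count p).

Definition root_sparse (q : nat -> {poly C}) (U : set C) : Prop :=
  open U /\
  forall K : set C, compact K -> K `<=` U ->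
    exists M : R, \forall k \near \oo, (root_count (q k) K <= M%:E)%E.

End RootMeasures.

Section Divisors.
Variable R : realType.
Local Notation C := (Cplx R).
Implicit Types (U : set C) (phi : C -> C) (p : {poly C}).

(* A divisor on U; the values of div_fun outside U are irrelevant. *)
Record divisor U := Divisor {
  div_fun :> C -> int;
  div_no_limit_point :
    forall z, U z -> ~ limit_point [set w | U w /\ div_fun w != 0] z }.

(* Continuous functions with compact support in U, extended by 0 to C. *)
Definition Cc U phi : Prop :=
  [/\ continuous phi,
      compact (closure [set z | phi z != 0]) &
      closure [set z | phi z != 0] `<=` U].

(* For phi in Cc U only finitely many terms are nonzero (a finitely supported
   sum with infinite support would be 0 by convention). *)
Definition div_act U (xi : divisor U) phi : C :=
  \sum_(z \in U) (xi z)%:~R * phi z.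

Lemma finite_roots p : finite_set [set w : C | (mup w p)%:Z != 0].
Proof.
have [->|p0] := eqVneq p 0.
  apply: sub_finite_set (@finite_set0 C) => w /=.
  rewrite /mup; case: arg_maxnP => //= i _ _.
  by case: i => -[|n] //=; rewrite size_poly0.
apply: sub_finite_set (finite_seq (proots p)) => w /= mw.
have : root p w by apply: contraNT mw => /mupNroot ->.
rewrite /proots; case: closed_field_poly_normal => s /= ->.
by rewrite rootZ ?lead_coef_eq0 // root_prod_XsubC.
Qed.

Lemma mup_no_limit_point U p z : U z ->
  ~ limit_point [set w | U w /\ (mup w p)%:Z != 0] z.
Proof.
move=> _; set E := [set w | _] => lim.
have clE : closed (E `\ z).
  have T1 : accessible_space C := hausdorff_accessible (@norm_hausdorff _ C).
  have [finite_closed _] := @accessible_finite_set_closed C.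
  apply: (finite_closed T1).
  by apply: sub_finite_set (finite_roots p) => w [[]].
have [|y [/eqP yz Ey]] := lim (~` (E `\ z)); last by apply; split.
by apply: open_nbhs_nbhs; split; [exact: closed_openC | case=> _; apply].
Qed.

(* The divisor of zeros of a polynomial: the value at z is the order of the
   zero of p at z.  Only meaningful for p != 0 (mup z 0 = 0 by convention). *)
Definition zero_div U p : divisor U :=
  Divisor (@mup_no_limit_point U p).

End Divisors.

(* Main.v *)
Require Import Defs.
From HB Require Import structures.
From mathcomp Require Import all_boot all_order all_algebra.
From mathcomp Require Import complex ring lra zify.
From mathcomp Require Import all_classical all_reals all_analysis.
Import Order.TTheory GRing.Theory Num.Theory.
Import numFieldNormedType.Exports.
Local Open Scope classical_set_scope.
Local Open Scope ring_scope.

(** Write V for the complement of U and call a point far if its distance to V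
    is at least a fixed eta > 0.  By sparseness only boundedly many roots a of
    q_k are far; all the others lie near V, in a fixed disc.

    Consider q_k'/q_k, which is the sum of 1/(z - a) over the roots a.  Take x
    with a slightly larger distance to V, and let v be the point of V closest
    to x.  Since V is convex, every root a near V satisfies
    Re (u / (z - a)) >= kappa > 0 for the direction u of x - v, for all z close
    to x, with kappa independent of k ([half_plane]).  There are at least
    n_k - M such roots, and the at most M far roots contribute at most M/s in
    modulus when z stays at distance s from them.  As n_k tends to infinity the
    real part of u q_k'/q_k exceeds 1 at all such z
    ([log_derivative_half_plane]): the derivative has no zero there, and on a
    circle of such points q_k'/q_k takes its values in an open half-plane, so
    that its argument has no variation and q_k and q_k' have the same number of
    roots inside.

    To find good circles, the far roots are grouped into clusters of radius s
    whose centres are more than 5 s apart ([exists_clusters]); s can be chosen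
    below any given bound and above a positive bound independent of k.  The
    discs of radius 2 s about the centres are then disjoint, their boundaries
    stay at distance s from the far roots, they contain all roots of q_k and
    q_k' at distance at least 4 eta from V, and each contains equally many of
    both ([derivative_shared_discs]).  A uniformly continuous function supported
    at distance 4 eta from V therefore has nearly the same sum over the roots of
    q_k and over those of q_k'; this is the case m = 1.  The same discs show that
    the derivatives form again a root-sparse sequence, and their roots remain in
    the same disc by Gauss-Lucas, so the argument can be iterated
    ([root_sum_derivn_near]).

    The equality of the root counts replaces the argument principle and is
    proved without integration ([count_disc_eq]).  On the unit circle let F be a
    quotient of products of linear factors with Re F >= c > 0.  Multiplying F by
    positive functions turns each zero b inside the disc into
    w / (1 - conj b * w) and each pole a inside into (1 - conj a * w) / w.  With
    more zeros than poles inside, F becomes w h(w), still of real part bounded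
    below, where h is a uniform limit of polynomials on the circle.  But a
    polynomial vanishing at 0 has nonpositive real part somewhere on the circle
    ([exists_re_horner_le0]), a contradiction. *)

Set Implicit Arguments.
Unset Strict Implicit.
Unset Printing Implicit Defensive.

(** * The real-valued modulus and real part *)

Section Modulus.
Variable R : realType.
Local Notation C := (Cplx R).
Implicit Types z w : C.

Definition re z : R := complex.Re z.
(** The library norm takes its values in C, where the order is only partial;
    with values in R the usual estimates apply. *)
Definition nm z : R := complex.Re `|z|.
Definition cj z : C := (z^*)%C.
Definition rc (t : R) : C := (t%:C)%C.

Lemma nmE z : `|z| = rc (nm z).
Proof. by rewrite /rc /nm -[RHS]/((complex.Re `|z|)%:C)%C RRe_real // normr_real. Qed.

Lemma reD z w : re (z + w) = re z + re w.
Proof. by case: z w => a b [c d]. Qed.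

Lemma reN z : re (- z) = - re z.
Proof. by case: z. Qed.

Lemma reB z w : re (z - w) = re z - re w.
Proof. by rewrite reD reN. Qed.

Lemma re0 : re 0 = 0. Proof. by []. Qed.

Lemma re_sum I (s : seq I) (P : pred I) (F : I -> C) :
  re (\sum_(i <- s | P i) F i) = \sum_(i <- s | P i) re (F i).
Proof. exact: (big_morph re reD re0). Qed.

Lemma re_rcM (t : R) z : re (rc t * z) = t * re z.
Proof. by case: z => a b /=; rewrite /re /= mul0r subr0. Qed.

Lemma nm_ge0 z : 0 <= nm z.
Proof. by rewrite -ler0c -/(rc (nm z)) -nmE normr_ge0. Qed.

Lemma nm0 : nm 0 = 0.
Proof. by rewrite /nm normr0. Qed.

Lemma nm1 : nm 1 = 1.
Proof. by rewrite /nm normr1. Qed.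

Lemma nm_eq0 z : (nm z == 0) = (z == 0).
Proof.
apply/eqP/eqP => [h|->]; last exact: nm0.
by apply/normr0_eq0; rewrite nmE h.
Qed.

Lemma nm_gt0 z : (0 < nm z) = (z != 0).
Proof. by rewrite lt_def nm_ge0 andbT nm_eq0. Qed.

Lemma nmM z w : nm (z * w) = nm z * nm w.
Proof. by apply: complexI; rewrite rmorphM -!/(rc _) -!nmE normrM. Qed.

Lemma nmN z : nm (- z) = nm z.
Proof. by rewrite /nm normrN. Qed.

Lemma nmBC z w : nm (z - w) = nm (w - z).
Proof. by rewrite -nmN opprB. Qed.

Lemma nmV z : nm z^-1 = (nm z)^-1.
Proof. by apply: complexI; rewrite fmorphV -!/(rc _) -!nmE normfV. Qed.

Lemma nmX z n : nm (z ^+ n) = nm z ^+ n.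
Proof. by elim: n => [|n ih]; rewrite ?expr0 ?nm1 // !exprS nmM ih. Qed.

Lemma ler_nmD z w : nm (z + w) <= nm z + nm w.
Proof. by rewrite -lecR rmorphD -!/(rc _) -!nmE; exact: ler_normD. Qed.

Lemma ler_nmB z w : nm z - nm w <= nm (z - w).
Proof. by rewrite lerBlDr; apply: le_trans (ler_nmD _ _); rewrite subrK. Qed.

Lemma ler_nm_dist x z w : nm (x - w) <= nm (x - z) + nm (z - w).
Proof. by apply: le_trans (ler_nmD _ _); rewrite addrA subrK. Qed.

Lemma ler_nm_sum I (s : seq I) (P : pred I) (F : I -> C) :
  nm (\sum_(i <- s | P i) F i) <= \sum_(i <- s | P i) nm (F i).
Proof.
apply: (big_ind2 (fun x y => nm x <= y)) => //; first by rewrite nm0.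
by move=> a b c d ab cd; apply: le_trans (ler_nmD _ _) (lerD ab cd).
Qed.

Lemma ler_re_nm z : `|re z| <= nm z.
Proof. by rewrite -lecR -/(rc (nm z)) -nmE; exact: normc_ge_Re. Qed.

Lemma rcM s t : rc (s * t) = rc s * rc t.
Proof. exact: (rmorphM (real_complex R)). Qed.

Lemma rcV t : rc t^-1 = (rc t)^-1.
Proof. exact: (fmorphV (real_complex R)). Qed.

Lemma rcX t n : rc (t ^+ n) = rc t ^+ n.
Proof. exact: (rmorphXn (real_complex R)). Qed.

Lemma rc_eq0 t : (rc t == 0) = (t == 0).
Proof. exact: (fmorph_eq0 (real_complex R)). Qed.

Lemma nm_rc t : nm (rc t) = `|t|.
Proof.
apply: complexI; rewrite -[LHS]/(rc (nm (rc t))) -nmE.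
by rewrite -[LHS]/(`|t%:C|)%C normc_def /= expr0n addr0 sqrtr_sqr.
Qed.

Lemma nm_sqr z : nm z ^+ 2 = re z ^+ 2 + complex.Im z ^+ 2.
Proof. by apply: complexI; rewrite [RHS]add_Re2_Im2 [`|_|](nmE z) -rcX. Qed.

Lemma re_inv z : re z^-1 = re z / nm z ^+ 2.
Proof. by rewrite nm_sqr; case: z => a b. Qed.

Lemma cjB z w : cj (z - w) = cj z - cj w.
Proof. exact: (rmorphB (@conjc R)). Qed.

Lemma nm_cj z : nm (cj z) = nm z.
Proof. by rewrite /nm /cj [in LHS]normcJ. Qed.

Lemma mul_cj z : z * cj z = rc (nm z ^+ 2).
Proof. by rewrite -[LHS](sqr_normc z) [`|_|](nmE z) rcX. Qed.

End Modulus.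

(** * Counting zeros and poles inside a circle *)

Section CircleCounting.
Variable R : realType.
Local Notation C := (Cplx R).
Implicit Types (z w a b : C) (p : {poly C}) (A B : seq C).

(** A weak mean value property.  Averaging p over w and -w leaves the even part
    of p at w ^+ 2, which has smaller degree and the same value at 0; so one of
    the two values has real part at most that of the even part at w ^+ 2. *)
Lemma exists_re_horner_le0 p : p.[0] = 0 -> exists2 w, nm w = 1 & re p.[w] <= 0.
Proof.
have [n] := ubnP (size p); elim: n p => // n ih p szp p0.
have [sz1|sz2] := leqP (size p) 1.
  exists 1; first exact: nm1.
  have := size1_polyC sz1; move: p0; rewrite horner_coef0 => -> ->.
  by rewrite hornerC re0.
have [||v v1 vle] := ih (even_poly p).
- apply: leq_ltn_trans (size_even_poly p) _.
  by move: szp sz2; set k := size p; rewrite uphalfE; lia.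
- by rewrite horner_coef0 coef_even_poly -horner_coef0.
pose w := sqrtC v.
have ww : w ^+ 2 = v by exact: sqrtCK.
have w1 : nm w = 1.
  by apply/eqP; rewrite -sqrp_eq1 ?nm_ge0 // -nmX ww v1.
have sum2 : p.[w] + p.[- w] = (even_poly p).[v] + (even_poly p).[v].
  rewrite -{1 2}[p]poly_even_odd !hornerD !hornerM !hornerX !horner_comp.
  by rewrite !hornerXn sqrrN ww mulrN addrACA subrr addr0.
have [pw|pw] := leP (re p.[w]) 0; first by exists w.
exists (- w); first by rewrite nmN.
by move: (congr1 (@re R) sum2); rewrite !reD; lra.
Qed.

(** The boundary values of the disc algebra: uniform limits on the unit circle
    of polynomials. *)
Definition disc_approx (h : C -> C) := forall e : R, 0 < e ->
  exists p, forall w, nm w = 1 -> nm (h w - p.[w]) <= e.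

Lemma disc_approx_poly p : disc_approx (horner p).
Proof. by move=> e e0; exists p => w _; rewrite subrr nm0 ltW. Qed.

Lemma poly_circle_bounded p : exists2 M : R, 0 < M &
  forall w, nm w = 1 -> nm p.[w] <= M.
Proof.
elim/poly_ind: p => [|p c [M M0 ih]].
  by exists 1 => // w _; rewrite horner0 nm0.
exists (M + nm c); first by rewrite ltr_wpDr ?nm_ge0.
move=> w w1; rewrite !hornerE; apply: le_trans (ler_nmD _ _) _.
by rewrite lerD2r nmM w1 mulr1 ih.
Qed.

Lemma disc_approxM g h : disc_approx g -> disc_approx h ->
  disc_approx (fun w => g w * h w).
Proof.
move=> ag ah e e0.
have [q hq] := ah 1 ltr01.
have [M M0 qM] := poly_circle_bounded q.
have [|p hp] := ag (e / (2 * (M + 1))); first by rewrite divr_gt0 //; lra.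
have [N N0 pN] := poly_circle_bounded p.
have [|q' hq'] := ah (e / (2 * N)); first by rewrite divr_gt0 //; lra.
exists (p * q') => w w1.
have -> : g w * h w - (p * q').[w] =
    (g w - p.[w]) * h w + p.[w] * (h w - q'.[w]) by rewrite hornerM; ring.
apply: le_trans (ler_nmD _ _) _; rewrite !nmM.
have hb : nm (h w) <= M + 1.
  rewrite -[h w](subrK q.[w]); apply: le_trans (ler_nmD _ _) _.
  by have := hq w w1; have := qM w w1; lra.
have -> : e = e / (2 * (M + 1)) * (M + 1) + N * (e / (2 * N)).
  by field; rewrite (gt_eqF N0) /= gt_eqF //; lra.
by apply: lerD; apply: ler_pM; rewrite ?nm_ge0 ?hp ?pN ?hq'.
Qed.

Lemma disc_approx_eq g h : (forall w, nm w = 1 -> g w = h w) ->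
  disc_approx g -> disc_approx h.
Proof.
by move=> gh ag e /ag [p hp]; exists p => w w1; rewrite -gh ?hp.
Qed.

Lemma disc_approx_geometric c : nm c < 1 -> disc_approx (fun w => (1 - c * w)^-1).
Proof.
move=> c1 e e0; have c0 := nm_ge0 c.
have cvg0 : (fun n => nm c ^+ n) @ \oo --> (0 : R).
  by apply: cvg_expr; rewrite ger0_norm.
have d0 : 0 < e * (1 - nm c) by rewrite mulr_gt0 ?subr_gt0.
have [n _ hn] := (cvgrPdist_lt _ _).1 cvg0 _ d0.
have {hn} := hn n (leqnn n); rewrite sub0r normrN ger0_norm ?exprn_ge0 // => hn.
exists (\sum_(i < n) (c ^+ i) *: 'X^i) => w w1.
have cw : nm (c * w) = nm c by rewrite nmM w1 mulr1.
have lb : 1 - nm c <= nm (1 - c * w).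
  by have := ler_nmB 1 (c * w); rewrite nm1 cw.
have nz : 1 - c * w != 0 by rewrite -nm_gt0; lra.
have -> : (\sum_(i < n) (c ^+ i) *: 'X^i).[w] = \sum_(i < n) (c * w) ^+ i.
  by rewrite horner_sum; apply: eq_bigr => i _; rewrite !hornerE exprMn.
have -> : (1 - c * w)^-1 - \sum_(i < n) (c * w) ^+ i = (c * w) ^+ n / (1 - c * w).
  apply: (mulfI nz); rewrite mulrBr divff // mulrCA divff // mulr1.
  have -> : 1 - c * w = - (c * w - 1) by rewrite opprB.
  by rewrite mulNr -subrX1 opprK addrCA subrr addr0.
rewrite nmM nmV nmX cw ler_pdivrMr; last lra.
by apply: le_trans (ltW hn) _; rewrite ler_pM2l.
Qed.

(** On the unit circle conj w = 1 / w, so the reflected factor 1 - conj b * w is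
    a positive multiple of w / (w - b). *)
Lemma conj_on_circle w b : nm w = 1 ->
  (w - b) * (1 - cj b * w) = rc (nm (w - b) ^+ 2) * w.
Proof.
move=> w1; have := mul_cj w; rewrite w1 expr1n => ww.
rewrite -mul_cj -mulrA; congr (_ * _).
by rewrite cjB mulrBl [cj w * w]mulrC ww.
Qed.

(** Dividing by the positive number |w - b|^2 turns a zero b inside the disc
    into w / (1 - conj b * w), the product of w and a member of the disc algebra;
    the zeros outside are kept.  The bound l survives because |w - b| <= 2. *)
Lemma circle_zeros B : (forall b, b \in B -> nm b != 1) ->
  exists u : C -> C, exists lam : C -> R, exists l : R,
  [/\ disc_approx u, 0 < l & forall w, nm w = 1 -> l <= lam w /\
     (\prod_(b <- B) (w - b)) * rc (lam w)
       = w ^+ (count (fun b => nm b < 1) B) * u w].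
Proof.
elim: B => [|b B ih] nB.
  exists (fun=> 1), (fun=> 1), 1; split => //.
    by apply: disc_approx_eq (disc_approx_poly 1) => w _; rewrite hornerC.
  by move=> w w1; rewrite big_nil expr0 lexx.
have [c cB|u [lam [l [au l0 ul]]]] := ih; first by rewrite nB // inE cB orbT.
have [b1|b1] := boolP (nm b < 1).
- exists (fun w => (1 - cj b * w)^-1 * u w),
    (fun w => lam w * (nm (w - b) ^+ 2)^-1), (l * (2 ^+ 2)^-1); split.
  + apply: disc_approxM => //; apply: disc_approx_geometric.
    by rewrite nm_cj.
  + by rewrite mulr_gt0 // invr_gt0 exprn_gt0.
  move=> w w1; have [llam eqw] := ul w w1.
  have wb : 0 < nm (w - b).
    by apply: lt_le_trans (ler_nmB _ _); rewrite w1 subr_gt0.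
  have wb2 : nm (w - b) <= 2.
    by apply: le_trans (ler_nmD _ _) _; rewrite nmN w1; lra.
  split.
    rewrite ler_pM ?invr_ge0 ?(ltW l0) ?exprn_ge0 //.
    by rewrite lef_pV2 ?posrE ?exprn_gt0 // lerXn2r // ?nnegrE ?ltW.
  have -> : count (fun b => nm b < 1) (b :: B) = (count (fun b => nm b < 1) B).+1.
    by rewrite /= b1.
  rewrite big_cons [w ^+ _.+1]exprS rcM.
  have := conj_on_circle b w1; set D := rc _ => eqD.
  have D0 : D != 0.
    by rewrite /D rc_eq0 expf_neq0 // gt_eqF.
  have w0 : w != 0 by rewrite -nm_gt0 w1.
  have nz : 1 - cj b * w != 0.
    apply: contraTneq (mulf_neq0 D0 w0) => nz.
    by rewrite -eqD nz mulr0 eqxx.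
  transitivity (((\prod_(b <- B) (w - b)) * rc (lam w)) * ((w - b) / D)).
    by rewrite rcV -/D [(w - b) * _]mulrC mulrACA.
  have -> : (w - b) / D = w / (1 - cj b * w).
    by apply/eqP; rewrite eqr_div // eqD mulrC.
  by rewrite eqw; move: (_^-1) => V; ring.
- exists (fun w => (w - b) * u w), lam, l; split => //.
    apply: disc_approxM => //.
    by apply: disc_approx_eq (disc_approx_poly ('X - b%:P)) => w _; rewrite !hornerE.
  move=> w w1; have [llam eqw] := ul w w1; split=> //.
  by rewrite big_cons /= (negbTE b1) add0n -mulrA eqw; ring.
Qed.

(** The counterpart for poles.  A pole a inside the disc, multiplied by
    |w - a|^2, becomes (1 - conj a * w) / w, and a pole outside is already in the
    disc algebra, by the geometric series in w / a. *)
Lemma circle_poles A : (forall a, a \in A -> nm a != 1) ->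
  exists v : C -> C, exists lam : C -> R, exists l : R,
  [/\ disc_approx v, 0 < l & forall w, nm w = 1 -> l <= lam w /\
     w ^+ (count (fun a => nm a < 1) A) * ((\prod_(a <- A) (w - a))^-1
       * rc (lam w)) = v w].
Proof.
elim: A => [|a A ih] nA.
  exists (fun=> 1), (fun=> 1), 1; split => //.
    by apply: disc_approx_eq (disc_approx_poly 1) => w _; rewrite hornerC.
  by move=> w w1; rewrite big_nil expr0 invr1 !mul1r lexx.
have [c cA|u [lam [l [au l0 ul]]]] := ih; first by rewrite nA // inE cA orbT.
have [a1|a1] := boolP (nm a < 1).
- exists (fun w => (1 - cj a * w) * u w),
    (fun w => lam w * nm (w - a) ^+ 2), (l * (1 - nm a) ^+ 2); split.
  + apply: disc_approxM => //.
    apply: disc_approx_eq (disc_approx_poly (1 - cj a *: 'X)) => w _.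
    by rewrite !hornerE.
  + by rewrite mulr_gt0 // exprn_gt0 ?subr_gt0.
  move=> w w1; have [llam eqw] := ul w w1.
  have wa : 1 - nm a <= nm (w - a) by have := ler_nmB w a; rewrite w1.
  split.
    rewrite ler_pM ?(ltW l0) ?exprn_ge0 // ?subr_ge0 ?(ltW a1) //.
    by rewrite lerXn2r // ?nnegrE ?nm_ge0 ?subr_ge0 ?ltW.
  have -> : count (fun a => nm a < 1) (a :: A) = (count (fun a => nm a < 1) A).+1.
    by rewrite /= a1.
  rewrite big_cons [w ^+ _.+1]exprS rcM invfM.
  have wa0 : w - a != 0 by rewrite -nm_gt0; apply: lt_le_trans wa; rewrite subr_gt0.
  rewrite -eqw; have := conj_on_circle a w1.
  set D := rc _ => eqD.
  have -> : 1 - cj a * w = (w - a)^-1 * (D * w) by rewrite -eqD mulKf.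
  by ring.
- exists (fun w => (w - a)^-1 * u w), lam, l; split => //.
    have a2 : 1 < nm a by rewrite lt_def nA ?inE ?eqxx // leNgt.
    have a0 : a != 0 by rewrite -nm_gt0; lra.
    apply: disc_approxM => //.
    apply: (@disc_approx_eq (fun w => (- a^-1) * (1 - a^-1 * w)^-1)).
      move=> w w1.
      have wa0 : w - a != 0.
        by rewrite -nm_gt0 nmBC; apply: lt_le_trans (ler_nmB _ _); lra.
      have -> : 1 - a^-1 * w = - a^-1 * (w - a) by field.
      by rewrite invfM mulrA mulfV ?mul1r // oppr_eq0 invr_eq0.
    apply: disc_approxM.
      apply: disc_approx_eq (disc_approx_poly (- a^-1)%:P) => w _.
      by rewrite !hornerE.
    apply: disc_approx_geometric.
    by rewrite nmV invf_lt1 //; lra.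
  move=> w w1; have [llam eqw] := ul w w1; split=> //.
  by rewrite big_cons /= (negbTE a1) add0n -eqw invfM; ring.
Qed.

(** With more zeros than poles inside the disc, the positive multiple of the
    quotient given by [circle_zeros] and [circle_poles] is w h(w) with h in the
    disc algebra.  Replacing h by a polynomial contradicts
    [exists_re_horner_le0]. *)
Lemma count_disc_le (c : C) A B (c0 : R) : 0 < c0 ->
  (forall w, nm w = 1 ->
     c0 <= re (c * (\prod_(b <- B) (w - b) / \prod_(a <- A) (w - a)))) ->
  (count (fun b => (nm b < 1)%R) B <= count (fun a => (nm a < 1)%R) A)%N.
Proof.
move=> c00 hF; rewrite leqNgt; apply/negP => ltAB.
have notin s w : w \in s -> \prod_(b <- s) (w - b) = 0.
  by move=> ws; rewrite (big_rem _ ws) /= subrr mul0r.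
have nB b : b \in B -> nm b != 1.
  move=> bB; apply/eqP => /hF; rewrite (notin _ _ bB) mul0r mulr0 re0; lra.
have nA a : a \in A -> nm a != 1.
  by move=> aA; apply/eqP => /hF; rewrite (notin _ _ aA) invr0 !mulr0 re0; lra.
have [u [lam [l [au l0 ul]]]] := circle_zeros nB.
have [v [mu [m [av m0 vm]]]] := circle_poles nA.
set N := count _ B in ltAB ul; set d := count _ A in ltAB vm.
have [k eN] : exists k, N = (d + k.+1)%N.
  by exists (N - d).-1; rewrite prednK ?subn_gt0 // subnKC // ltnW.
pose h w := c * (w ^+ k * (u w * v w)).
have ah : disc_approx h.
  apply: disc_approxM.
    by apply: disc_approx_eq (disc_approx_poly c%:P) => w _; rewrite hornerC.
  apply: disc_approxM; last exact: disc_approxM.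
  apply: disc_approx_eq (disc_approx_poly 'X^k) => w _.
  by rewrite hornerXn.
have e0 : 0 < l * m * c0 by rewrite !mulr_gt0.
have hlb w : nm w = 1 -> l * m * c0 <= re (w * h w).
  move=> w1; have [ll eql] := ul w w1; have [mm eqm] := vm w w1.
  have -> : w * h w = rc (lam w * mu w) *
      (c * (\prod_(b <- B) (w - b) / \prod_(a <- A) (w - a))).
    have w0 : w != 0 by rewrite -nm_gt0 w1.
    apply: (mulfI (expf_neq0 d w0)).
    transitivity (c * (w ^+ N * u w) * v w).
      by rewrite /h eN exprD exprS; ring.
    rewrite -eql -eqm rcM; ring.
  rewrite re_rcM ler_pM ?hF //; first by rewrite mulr_ge0 ?ltW.
    exact: ltW.
  by apply: ler_pM => //; exact: ltW.
have [p hp] := ah _ (divr_gt0 e0 (ltr0n R 2)).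
have [|w w1] := @exists_re_horner_le0 ('X * p); first by rewrite hornerM hornerX mul0r.
rewrite hornerM hornerX => lew.
have := hlb w w1; have := hp w w1.
have := ler_re_nm (w * (h w - p.[w])).
rewrite nmM w1 mul1r mulrBr reB ler_norml => /andP[_].
by move=> h1 h2 h3; lra.
Qed.

Lemma circle_prod_bounded A : exists2 M : R, 0 < M &
  forall w, nm w = 1 -> nm (\prod_(a <- A) (w - a)) <= M.
Proof.
have [M M0 hM] := poly_circle_bounded (\prod_(a <- A) ('X - a%:P)).
exists M => // w /hM; rewrite horner_prod.
by under eq_bigr do rewrite !hornerE.
Qed.

Lemma circle_prodV_bounded A : (forall a, a \in A -> nm a != 1) ->
  exists2 M : R, 0 < M &
  forall w, nm w = 1 -> nm (\prod_(a <- A) (w - a))^-1 <= M.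
Proof.
elim: A => [|a A ih] nA.
  by exists 1 => // w _; rewrite big_nil invr1 nm1.
have [c cA|M M0 hM] := ih; first by rewrite nA // inE cA orbT.
have a1 : 0 < `|nm a - 1| by rewrite normr_gt0 subr_eq0 nA ?inE ?eqxx.
exists (`|nm a - 1|^-1 * M); first by rewrite mulr_gt0 ?invr_gt0.
move=> w w1; rewrite big_cons invfM nmM ler_pM ?nm_ge0 ?hM //.
have wa : `|nm a - 1| <= nm (w - a).
  have := ler_nmB w a; have := ler_nmB a w; rewrite w1 nmBC ler_norml; lra.
by rewrite nmV lef_pV2 // posrE; lra.
Qed.

(** The inverse of a number F with Re F >= c0 and |F| <= K has real part at least
    c0 / K ^+ 2, so zeros and poles can be exchanged in [count_disc_le]. *)
Lemma count_disc_eq (c : C) A B (c0 : R) : 0 < c0 ->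
  (forall w, nm w = 1 ->
     c0 <= re (c * (\prod_(b <- B) (w - b) / \prod_(a <- A) (w - a)))) ->
  count (fun b => nm b < 1) B = count (fun a => nm a < 1) A.
Proof.
move=> c00 hF; apply/eqP; rewrite eqn_leq (count_disc_le c00 hF) /=.
have nA a : a \in A -> nm a != 1.
  move=> aA; apply/eqP => /hF.
  by rewrite (big_rem _ aA) /= subrr mul0r invr0 !mulr0 re0; lra.
have [M M0 hM] := circle_prod_bounded B.
have [N N0 hN] := circle_prodV_bounded nA.
pose K := (nm c + 1) * (M * N).
have K0 : 0 < K by rewrite !mulr_gt0 // ltr_wpDl ?nm_ge0.
apply: (@count_disc_le c^-1 B A (c0 / K ^+ 2)).
  by rewrite divr_gt0 ?exprn_gt0.
move=> w w1; set F := c * (\prod_(b <- B) (w - b) / \prod_(a <- A) (w - a)).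
have -> : c^-1 * (\prod_(b <- A) (w - b) / \prod_(a <- B) (w - a)) = F^-1.
  by rewrite /F !invfM invrK; congr (_ * _); rewrite mulrC.
have Fc0 : c0 <= re F := hF w w1.
have F0 : 0 < nm F by have := ler_re_nm F; rewrite ler_norml; lra.
have FK : nm F <= K.
  rewrite !nmM; apply: ler_pM; rewrite ?mulr_ge0 ?nm_ge0 ?lerDl //.
  by apply: ler_pM; [exact: nm_ge0|exact: nm_ge0|exact: hM|exact: hN].
rewrite re_inv; apply: ler_pM => //; rewrite ?(ltW c00) ?invr_ge0 ?exprn_ge0 ?(ltW K0) //.
by rewrite lef_pV2 ?posrE ?exprn_gt0 // lerXn2r // ?nnegrE ?ltW.
Qed.

Lemma count_disc_affine (c x : C) (r : R) A B (c0 : R) : 0 < r -> 0 < c0 ->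
  (forall z, nm (z - x) = r ->
     c0 <= re (c * (\prod_(b <- B) (z - b) / \prod_(a <- A) (z - a)))) ->
  count (fun b => nm (b - x) < r) B = count (fun a => nm (a - x) < r) A.
Proof.
move=> r0 c00 hF.
pose rC : C := rc r.
have rC0 : rC != 0 by rewrite rc_eq0 gt_eqF.
have nmr : nm rC = r by rewrite nm_rc ger0_norm ?ltW.
pose f b := (b - x) / rC.
have cntf s : count (fun b => nm b < 1) (map f s)
              = count (fun b => nm (b - x) < r) s.
  rewrite count_map; apply: eq_count => b /=.
  by rewrite /f nmM nmV nmr ltr_pdivrMr // mul1r.
have prodf s w : \prod_(b <- s) (x + rC * w - b)
    = rC ^+ size s * \prod_(b <- map f s) (w - b).
  elim: s => [|b s ih]; first by rewrite !big_nil mulr1.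
  rewrite !big_cons ih exprS /f; have -> : x + rC * w - b = rC * (w - (b - x) / rC) by field.
  by ring.
rewrite -!cntf.
apply: (@count_disc_eq (c * (rC ^+ size B / rC ^+ size A)) _ _ c0) => // w w1.
have := hF (x + rC * w); rewrite addrAC subrr add0r nmM nmr w1 mulr1 !prodf.
move=> /(_ erefl); rewrite !invfM.
by congr (_ <= re _); ring.
Qed.

End CircleCounting.

(** * Roots of a polynomial and of its derivative *)

Section RootsOfDerivative.
Variable R : realType.
Local Notation C := (Cplx R).
Implicit Types (z w a b x : C) (p : {poly C}) (A B X : seq C).

Lemma re_div z w : re (z / w) = re (z * cj w) / nm w ^+ 2.
Proof.
rewrite nm_sqr; case: z => a b; case: w => c d.
rewrite /re /cj /=; ring.
Qed.

Lemma re_mul_cj_le z w : `|re (z * cj w)| <= nm z * nm w.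
Proof. by apply: le_trans (ler_re_nm _) _; rewrite nmM nm_cj. Qed.

Lemma nm_sqrB z w : nm (z - w) ^+ 2 = nm z ^+ 2 - 2 * re (z * cj w) + nm w ^+ 2.
Proof.
rewrite !nm_sqr; case: z => a b; case: w => c d.
rewrite /re /cj /=; ring.
Qed.

Lemma cjD z w : cj (z + w) = cj z + cj w.
Proof. by case: z w => a b [c d]; congr Complex; rewrite opprD. Qed.

Lemma prootsE p : p = lead_coef p *: \prod_(a <- proots p) ('X - a%:P).
Proof. by rewrite /proots; case: closed_field_poly_normal. Qed.

Lemma horner_proots p z : p.[z] = lead_coef p * \prod_(a <- proots p) (z - a).
Proof.
rewrite {1}(prootsE p) hornerZ horner_prod; congr (_ * _).
by apply: eq_bigr => a _; rewrite hornerXsubC.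
Qed.

Lemma size_proots p : p != 0 -> size (proots p) = (size p).-1.
Proof.
move=> p0; rewrite {2}(prootsE p) size_scale ?lead_coef_eq0 //.
by rewrite size_prod_XsubC.
Qed.

Lemma root_proots p z : p != 0 -> root p z = (z \in proots p).
Proof.
move=> p0; rewrite {1}(prootsE p) rootZ ?lead_coef_eq0 //.
by rewrite root_prod_XsubC.
Qed.

Lemma size_deriv_C p : size p^`() = (size p).-1.
Proof.
have [le1|lt1] := leqP (size p) 1.
  rewrite [p]size1_polyC // derivC size_poly0 size_polyC.
  by case: (_ == 0).
apply/eqP; rewrite eqn_leq; apply/andP; split.
  by rewrite -ltnS prednK ?(ltnW lt1) // lt_size_deriv // -size_poly_gt0 ltnW.
have e : (size p).-1 = (size p).-2.+1 by move: lt1; case: (size p) => [|[]].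
rewrite e; apply: contraTltn lt1 => /leq_sizeP /(_ _ (leqnn _)) /eqP.
rewrite coef_deriv -e -/(lead_coef p) mulrn_eq0 lead_coef_eq0 e /=.
by move=> /eqP ->; rewrite size_poly0.
Qed.

Lemma size_derivn_C p n : size p^`(n) = (size p - n)%N.
Proof.
by elim: n => [|n ih]; rewrite ?subn0 // derivnS size_deriv_C ih subnS.
Qed.

Lemma deriv_prod_XsubC A z : z \notin A ->
  (\prod_(a <- A) ('X - a%:P))^`().[z]
    = (\prod_(a <- A) ('X - a%:P)).[z] * \sum_(a <- A) (z - a)^-1.
Proof.
elim: A => [|a A ih]; first by rewrite !big_nil derivC horner0 mulr0.
rewrite inE negb_or => /andP[za /ih {}ih]; rewrite !big_cons derivM.
rewrite derivXsubC mul1r hornerD !hornerM ih hornerXsubC.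
set P := (\prod_(_ <- _) _).[z].
have h : z - a != 0 by rewrite subr_eq0.
by field.
Qed.

Lemma horner_deriv_proots p z : z \notin proots p ->
  p^`().[z] = p.[z] * \sum_(a <- proots p) (z - a)^-1.
Proof.
move=> /deriv_prod_XsubC h.
by rewrite {1 2}(prootsE p) derivZ !hornerZ h mulrA.
Qed.

Lemma sum_ge_count (F : C -> R) (P : pred C) A k :
  (forall a, a \in A -> P a -> k <= F a) ->
  k * (count P A)%:R <= \sum_(a <- A | P a) F a.
Proof.
elim: A => [|a A ih] hF; first by rewrite big_nil mulr0.
rewrite big_cons /= natrD mulrDr.
have {}ih : k * (count P A)%:R <= \sum_(a <- A | P a) F a.
  by apply: ih => b bA; apply: hF; rewrite inE bA orbT.
case: ifP => Pa; last by rewrite mulr0 add0r.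
by rewrite mulr1 lerD // hF // mem_head.
Qed.

(** If |b| > r then every b / (b - a) has positive real part, so the logarithmic
    derivative does not vanish at b. *)
Lemma gauss_lucas_disc p (r : R) : p^`() != 0 ->
  (forall a, a \in proots p -> nm a <= r) ->
  forall b, b \in proots p^`() -> nm b <= r.
Proof.
move=> p'0 hr b bp'; rewrite leNgt; apply/negP => rb.
have szp : (1 < size p)%N.
  by move: p'0; rewrite -size_poly_gt0 size_deriv_C; case: (size p) => [|[]].
have p0 : p != 0 by rewrite -size_poly_gt0 ltnW.
have bNp : b \notin proots p.
  by apply/negP => /hr; rewrite leNgt rb.
have : 0 < re (b * \sum_(a <- proots p) (b - a)^-1).
  rewrite mulr_sumr re_sum.
  have pos a : a \in proots p -> 0 < re (b / (b - a)).
    move=> ap; rewrite re_div cjB mulrBr reB mul_cj divr_gt0 //.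
      have := re_mul_cj_le b a; have := hr a ap; have := nm_ge0 a.
      rewrite /rc /re /=; set t := complex.Re _; rewrite ler_norml.
      by move=> h1 h2 /andP[h3 h4]; nra.
    rewrite exprn_gt0 // nm_gt0 subr_eq0; by apply: contraNneq bNp => ->.
  have : proots p != [::].
    by rewrite -size_eq0 size_proots // -lt0n; move: szp; case: (size p) => [|[]].
  case: (proots p) pos => // a s pos _; rewrite big_cons ltr_pwDl ?pos ?mem_head //.
  by rewrite big_seq sumr_ge0 // => c cs; rewrite ltW // pos // inE cs orbT.
have := bp'; rewrite -root_proots // => /rootP; rewrite horner_deriv_proots //.
move=> /eqP; rewrite mulf_eq0 => /orP[/eqP pb|/eqP ->]; last by rewrite mulr0 ltxx.
by move: bNp; rewrite -root_proots // => /rootP.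
Qed.

(** Five radii: discs of radius 2 t about the points of a set that is
    [spread X (5 * t)] are disjoint, and keep a distance from each other. *)
Definition spread X (s : R) :=
  forall x y, x \in X -> y \in X -> x != y -> s < nm (x - y).

(** As long as two centres are within 5 t, drop one of them and enlarge the
    radius from t to 6 t: the other centre takes over its points.  Each step
    removes a centre, which bounds the final radius. *)
Lemma exists_clusters A (s : R) : 0 < s ->
  exists X, exists t : R, [/\ uniq X, {subset X <= A},
    s <= t <= 6 ^+ size A * s, spread X (5 * t)
    & forall a, a \in A -> exists2 x, x \in X & nm (a - x) <= t].
Proof.
move=> s0.
suff gen n X t : (size X <= n)%N -> uniq X -> {subset X <= A} -> 0 < t ->
    (forall a, a \in A -> exists2 x, x \in X & nm (a - x) <= t) ->
  exists Y, exists t' : R, [/\ uniq Y, {subset Y <= A},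
    t <= t' <= 6 ^+ n * t, spread Y (5 * t')
    & forall a, a \in A -> exists2 x, x \in Y & nm (a - x) <= t'].
  apply: (gen _ (undup A)); rewrite ?size_undup ?undup_uniq //.
    by move=> x; rewrite mem_undup.
  by move=> a aA; exists a; rewrite ?mem_undup // subrr nm0 ltW.
elim: n X t => [|n ih] X t szX uX XA t0 cov.
  exists X, t; split; rewrite ?expr0 ?mul1r ?lexx //.
  by move=> x y; move: szX; case: X {uX XA cov}.
have [sepX|] := pselect (spread X (5 * t)).
  exists X, t; split=> //; rewrite lexx ler_peMl ?(ltW t0) //.
  by rewrite exprn_ege1 // ler1n.
move=> /existsNP[x /existsNP[y /not_implyP[xX /not_implyP[yX]]]].
move=> /not_implyP[xy /negP]; rewrite -leNgt => xyt.
have [| | | | |Y [t' [uY YA /andP[tt' t'le] sepY covY]]] := ih (rem y X) (6 * t).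
- by rewrite size_rem //; move: szX; case: (size X).
- exact: rem_uniq.
- by move=> z /mem_rem /XA.
- by rewrite mulr_gt0.
- move=> a aA; have [z zX az] := cov a aA.
  have [zy|zy] := eqVneq z y.
    exists x; first by rewrite mem_rem_uniq // inE xy.
    rewrite -zy in xyt; apply: le_trans (ler_nm_dist _ z _) _.
    by rewrite nmBC in xyt; lra.
  by exists z; [rewrite mem_rem_uniq // inE zy | lra].
exists Y, t'; split=> //; apply/andP; split; first lra.
by rewrite exprSr -mulrA.
Qed.

End RootsOfDerivative.

(** * Closed convex sets in the plane *)

Section PlaneTopology.
Variable R : realType.
Local Notation C := (Cplx R).
Implicit Types (z w a b x v : C) (U V K : set C).

Lemma nbhs_nmP z U :
  nbhs z U <-> exists2 e : R, 0 < e & forall w, nm (z - w) < e -> U w.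
Proof.
split=> [/nbhs_normP[e /= e0 eU]|[e e0 eU]].
  exists (nm e); first by rewrite nm_gt0 gt_eqF.
  move=> w zw; apply: eU => /=.
  by rewrite -[e]gtr0_norm // !nmE /rc ltcR.
apply/nbhs_normP; exists (rc e); first by rewrite /= /rc ltcR.
by move=> w /=; rewrite nmE /rc ltcR => /eU.
Qed.

Lemma near_nm (z : C) (e : R) : 0 < e -> \forall w \near z, nm (z - w) < e.
Proof. by move=> e0; apply/nbhs_nmP; exists e. Qed.

Lemma nm_continuous x : continuous (fun z : C => nm (x - z) : R).
Proof.
move=> z P /nbhs_normP[e /= e0 eP]; apply/nbhs_nmP; exists e => // w zw.
apply: eP; apply: le_lt_trans zw; rewrite ler_norml.
have := ler_nm_dist x z w; have := ler_nm_dist x w z; rewrite (nmBC w z); lra.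
Qed.

Lemma compact_disc (r : R) : compact [set z : C | nm z <= r].
Proof.
pose f (u : R * R) : C := Complex u.1 u.2.
have fc : continuous f.
  move=> [s t] P /nbhs_nmP[e e0 eP].
  have e2 : 0 < e / 2 by lra.
  have hs : \forall s' \near s, `|s - s'| < e / 2.
    by apply/nbhs_normP; exists (e / 2).
  have ht : \forall t' \near t, `|t - t'| < e / 2.
    by apply/nbhs_normP; exists (e / 2).
  exists ([set s' | `|s - s'| < e / 2], [set t' | `|t - t'| < e / 2]).
    by split.
  move=> [s' t'] /= [ss tt]; apply: eP.
  have -> : f (s, t) - f (s', t') = rc (s - s') + Complex 0 1 * rc (t - t').
    by rewrite /rc; congr Complex => /=; ring.
  apply: le_lt_trans (ler_nmD _ _) _; rewrite nmM !nm_rc.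
  have -> : nm (Complex 0 1 : C) = 1.
    apply/eqP; rewrite -sqrp_eq1 ?nm_ge0 // nm_sqr /re /=.
    by apply/eqP; ring.
  lra.
have cptQ : compact (f @` (`[- r, r]%classic `*` `[- r, r]%classic)).
  apply: continuous_compact; first exact: continuous_subspaceT.
  by apply: compact_setX; exact: segment_compact.
apply: subclosed_compact cptQ _.
  have -> : [set z : C | nm z <= r] = (fun z => nm (0 - z)) @^-1` [set t : R | t <= r].
    by apply/seteqP; split => z /=; rewrite sub0r nmN.
  by apply: closed_comp => [z _|]; [exact: nm_continuous|exact: closed_le].
move=> z /= zr; exists (complex.Re z, complex.Im z); last by case: (z).
have := nm_sqr z; rewrite /re; have := nm_ge0 z => n0 nq.
have r0 : 0 <= r := le_trans n0 zr.
by split; rewrite /= in_itv /=; apply/andP; split; nra.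
Qed.

Lemma closed_bounded_compact K (r : R) : closed K ->
  (forall z, K z -> nm z <= r) -> compact K.
Proof. by move=> cK Kr; apply: (subclosed_compact cK (@compact_disc r)) => z /Kr. Qed.

Definition far V (e : R) z := forall v, V v -> e <= nm (z - v).

Lemma closed_far V e : closed (far V e).
Proof.
move=> z clz v Vv; rewrite leNgt; apply/negP => zv.
have [|w [/(_ _ Vv) fw]] := clz [set w | nm (z - w) < e - nm (z - v)].
  by apply: near_nm; rewrite subr_gt0.
move=> /= zw; have := ler_nm_dist w z v; rewrite (nmBC w z); lra.
Qed.

(** The Lebesgue number of the covering of K by U alone. *)
Lemma compact_far U K : open U -> compact K -> K `<=` U ->
  exists2 e : R, 0 < e & K `<=` far (~` U) e.
Proof.
move=> oU /compact_near_coveringP cK KU.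
have /cK : forall z, K z -> \forall w \near z & e \near (0:R)^'+, far (~` U) e w.
  move=> z Kz; have /nbhs_nmP[e e0 eU] : nbhs z U.
    by apply: open_nbhs_nbhs; split=> //; exact: KU.
  have e2 : 0 < e / 2 by lra.
  exists ([set w | nm (z - w) < e / 2], [set t | t < e / 2]) => /=.
    by split; [exact: near_nm | exact: nbhs_right_lt].
  move=> [w t] /= [zw te] v Uv; rewrite leNgt; apply/negP => wv; apply: Uv.
  by apply: eU; apply: le_lt_trans (ler_nm_dist _ w _) _; lra.
move=> h; have [e [e0 he]] : exists e : R, [set e | 0 < e] e /\ K `<=` far (~` U) e.
  by apply: (@filter_ex _ (0:R)^'+); apply: filterI; [exact: nbhs_right_gt | exact: h].
by exists e.
Qed.

Lemma closest_point V x : closed V -> V !=set0 ->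
  exists2 v, V v & forall w, V w -> nm (x - v) <= nm (x - w).
Proof.
move=> cV [v0 Vv0].
pose K := V `&` [set w | nm (x - w) <= nm (x - v0)].
have cK : compact K.
  apply: (@closed_bounded_compact _ (nm x + nm (x - v0))).
    apply: closedI => //.
    by apply: (@closed_comp _ _ _ [set t : R | t <= _]) => [z _|]; [exact: nm_continuous|exact: closed_le].
  move=> w [_ /= wv]; have := ler_nmB w x; rewrite nmBC; lra.
have [||v /set_mem[Vv /= xv] vmin] := @compact_EVT_min _ R (fun w => nm (x - w)) K _ cK.
- by exists v0; split => /=.
- by apply: continuous_subspaceT; exact: nm_continuous.
exists v => // w Vw; have [wv|/ltW wv] := leP (nm (x - w)) (nm (x - v0)).
  by apply: vmin; apply/mem_set; split.
exact: le_trans wv.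
Qed.

Lemma uniform_continuity (phi : C -> C) K (e : R) : continuous phi -> compact K ->
  0 < e -> exists2 d : R, 0 < d &
    forall z w, K z -> nm (z - w) < d -> nm (phi z - phi w) < e.
Proof.
move=> cphi /compact_near_coveringP cK e0.
have e2 : 0 < e / 2 by lra.
have /cK : forall z, K z -> \forall z' \near z & d \near (0:R)^'+,
    forall w, nm (z' - w) < d -> nm (phi z' - phi w) < e.
  move=> z Kz; have /nbhs_nmP[d d0 dphi] := cphi z _ (near_nm (phi z) e2).
  have d2 : 0 < d / 2 by lra.
  exists ([set w | nm (z - w) < d / 2], [set t | t < d / 2]) => /=.
    by split; [exact: near_nm | exact: nbhs_right_lt].
  move=> [z' t] /= [zz td] w zw.
  have h1 : nm (phi z - phi z') < e / 2 by apply: dphi; lra.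
  have h2 : nm (phi z - phi w) < e / 2.
    by apply: dphi; have := ler_nm_dist z z' w; lra.
  by have := ler_nm_dist (phi z') (phi z) (phi w); rewrite (nmBC (phi z') (phi z)); lra.
move=> h; have [d [d0 hd]] : exists d : R, [set d | 0 < d] d /\ K `<=`
    [set z | forall w, nm (z - w) < d -> nm (phi z - phi w) < e].
  by apply: (@filter_ex _ (0:R)^'+); apply: filterI; [exact: nbhs_right_gt | exact: h].
by exists d => // z w /hd; exact.
Qed.

(** Convexity with the real segment written in the multiplication of C. *)
Definition real_convex V := forall v w (t : R), V v -> V w -> 0 <= t -> t <= 1 ->
  V (v + rc t * (w - v)).

Lemma convex_Cplx_real_convex V : convex_Cplx V -> real_convex V.
Proof.
move=> cV v w t Vv Vw t0 t1.
have := cV w v (Itv01 t0 t1) (mem_set Vw) (mem_set Vv) => /set_mem.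
congr V; rewrite /conv /=.
case: v w Vv Vw => a b [c d] _ _; rewrite /rc.
by congr Complex => /=; rewrite /unstable.onem; ring.
Qed.

(** Moving from v towards w by a small step t changes the squared distance to x
    by - 2 t Re ((x - v) conj (w - v)) + O(t^2), which must not be negative. *)
Lemma projection_obtuse V x v : real_convex V -> V v ->
  (forall w, V w -> nm (x - v) <= nm (x - w)) ->
  forall w, V w -> re ((x - v) * cj (w - v)) <= 0.
Proof.
move=> cV Vv vmin w Vw; rewrite leNgt; apply/negP; set g := re _ => g0.
have wv0 : 0 <= nm (w - v) ^+ 2 by rewrite exprn_ge0 // nm_ge0.
pose t := g / (g + nm (w - v) ^+ 2).
have D0 : 0 < g + nm (w - v) ^+ 2 by lra.
have t0 : 0 < t by rewrite divr_gt0.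
have t1 : t <= 1 by rewrite ler_pdivrMr //; lra.
have := vmin _ (cV v w t Vv Vw (ltW t0) t1).
rewrite -(@ler_pXn2r _ 2) ?nnegrE ?nm_ge0 // opprD addrA (nm_sqrB (x - v)) nmM nm_rc.
have -> : re ((x - v) * cj (rc t * (w - v))) = t * g.
  rewrite /g -re_rcM; congr re.
  have -> : cj (rc t * (w - v)) = rc t * cj (w - v).
    by case: (w - v) => a b; congr Complex => /=; ring.
  by ring.
have -> : (`|t| * nm (w - v)) ^+ 2 = t * (t * nm (w - v) ^+ 2).
  by rewrite ger0_norm ?(ltW t0) //; ring.
have tg : t * nm (w - v) ^+ 2 <= g.
  by rewrite /t mulrAC ler_pdivrMr // ler_pM2l //; lra.
nra.
Qed.

(** The direction is that from the closest point v of V to x, which is at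
    distance rho >= 3 eta from x.  For a within eta of V and z within eta / 2 of
    x, the component of z - a in this direction is at least
    rho - 3/2 eta >= 3/2 eta, by [projection_obtuse]. *)
Lemma half_plane V x (eta r : R) : closed V -> real_convex V -> 0 < eta ->
  far V (3 * eta) x -> nm x <= r -> exists2 u, nm u = 1 &
  forall z a, nm (z - x) <= eta / 2 -> ~ far V eta a -> nm a <= r ->
    eta / (2 * r + eta) ^+ 2 <= re (u / (z - a)).
Proof.
move=> cV coV eta0 fx xr.
have r0 : 0 <= r := le_trans (nm_ge0 x) xr.
(* When V is empty every point is far, and there is nothing to bound. *)
have [V0|] := pselect (V !=set0); last first.
  move=> nV; exists 1; first exact: nm1.
  by move=> z a _ nf; case: nf => v Vv; case: nV; exists v.
have [v Vv vmin] := closest_point x cV V0.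
have vob := projection_obtuse coV Vv vmin.
pose rho := nm (x - v); have rho3 : 3 * eta <= rho by exact: fx.
have rho0 : 0 < rho by lra.
exists ((x - v) * (rc rho)^-1).
  by rewrite nmM nmV nm_rc gtr0_norm // divff // gt_eqF.
move=> z a zx /existsNP[w /not_implyP[Vw /negP]]; rewrite -ltNge => aw ar.
have lb : rho * (3 / 2 * eta) <= re ((x - v) * cj (z - a)).
  have -> : z - a = (x - v) + (z - x) - (w - v) - (a - w) by ring.
  have expand (s q t u : C) : re (u * cj (u + s - q - t)) =
      nm u ^+ 2 + re (u * cj s) - re (u * cj q) - re (u * cj t).
    by rewrite !cjB cjD !mulrBr mulrDr !reB reD mul_cj.
  rewrite expand -/rho.
  have := re_mul_cj_le (x - v) (z - x); have := re_mul_cj_le (x - v) (a - w).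
  rewrite -/rho !ler_norml => /andP[_ h2] /andP[h1 _].
  have h3 := vob _ Vw.
  have h4 : rho * nm (z - x) <= rho * (eta / 2) by rewrite ler_pM2l.
  have h5 : rho * nm (a - w) <= rho * eta by rewrite ler_pM2l // ltW.
  nra.
have za0 : 0 < nm (z - a).
  rewrite nm_gt0; apply: contraTneq lb => ->.
  have -> : cj 0 = 0 :> C by rewrite /cj conjc0.
  by rewrite mulr0 re0 -ltNge !mulr_gt0 //; lra.
have zar : nm (z - a) <= 2 * r + eta.
  have := ler_nm_dist z x a; have := ler_nmD x (- a); rewrite nmN; lra.
have -> : (x - v) * (rc rho)^-1 / (z - a) = rc rho^-1 * ((x - v) / (z - a)).
  by rewrite rcV; ring.
rewrite re_rcM re_div mulrA ler_pM //.
- exact: ltW.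
- by rewrite invr_ge0 exprn_ge0 //; lra.
- rewrite mulrC ler_pdivlMr //; nra.
- rewrite lef_pV2 ?posrE ?exprn_gt0 //; last lra.
  by rewrite lerXn2r // nnegrE; lra.
Qed.

End PlaneTopology.
(** * Discs sharing the roots of a polynomial and of its derivative *)

Section Clusters.
Variable R : realType.
Local Notation C := (Cplx R).
Implicit Types (z w a b x : C) (p : {poly C}) (A B X : seq C) (V : set C).

(** The roots near V contribute at least kappa each by [half_plane], the far ones
    at least - 1 / s each; the numerical hypothesis says that the former win. *)
Lemma log_derivative_half_plane V x (eta r s : R) (M : nat) p :
  closed V -> real_convex V -> 0 < eta -> 0 < s -> far V (3 * eta) x -> nm x <= r ->
  (forall a, a \in proots p -> nm a <= r) ->
  (count (fun a => `[< far V eta a >]) (proots p) <= M)%N ->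
  1 + M%:R / s <= (size (proots p) - M)%:R * (eta / (2 * r + eta) ^+ 2) ->
  exists u, forall z, nm (z - x) <= eta / 2 ->
    (forall a, a \in proots p -> far V eta a -> s <= nm (z - a)) ->
    z \notin proots p /\ 1 <= re (u * \sum_(a <- proots p) (z - a)^-1).
Proof.
move=> cV coV eta0 s0 fx xr pr pM big.
have r0 : 0 <= r := le_trans (nm_ge0 x) xr.
set kappa := eta / _ in big.
have k0 : 0 < kappa by rewrite divr_gt0 // exprn_gt0 //; lra.
have [u u1 hu] := half_plane cV coV eta0 fx xr.
exists u => z zx zs.
have near_ge a : a \in proots p -> ~~ `[< far V eta a >] -> kappa <= re (u / (z - a)).
  by move=> ap /asboolPn nf; apply: hu => //; exact: pr.
split.
  apply/negP => zp; have [/asboolP fz|nf] := boolP `[< far V eta z >].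
    by have := zs z zp fz; rewrite subrr nm0; lra.
  by have := near_ge z zp nf; rewrite subrr invr0 mulr0 re0; lra.
rewrite mulr_sumr re_sum (bigID (fun a => `[< far V eta a >])) /=.
have h1 := sum_ge_count near_ge.
have h2 : - s^-1 * (count (fun a => `[< far V eta a >]) (proots p))%:R <=
    \sum_(a <- proots p | `[< far V eta a >]) re (u / (z - a)).
  apply: sum_ge_count => a ap /asboolP fa.
  have za := zs a ap fa.
  have : nm (u / (z - a)) <= s^-1.
    by rewrite nmM u1 mul1r nmV lef_pV2 // posrE; lra.
  by have := ler_re_nm (u / (z - a)); rewrite ler_norml; lra.
set n := size _ in big.
have h3 : (n - M)%:R <= (count (fun a => ~~ `[< far V eta a >]) (proots p))%:R :> R.
  rewrite ler_nat /n -(count_predC (fun a => `[< far V eta a >]) (proots p)).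
  by move: pM; set c1 := count _ _; set c2 := count (predC _) _; lia.
have h4 : (count (fun a => `[< far V eta a >]) (proots p))%:R / s <= M%:R / s :> R.
  by rewrite ler_pM2r ?invr_gt0 // ler_nat.
have h5 : (n - M)%:R * kappa <= kappa * (count (fun a => ~~ `[< far V eta a >]) (proots p))%:R.
  by rewrite mulrC ler_pM2l.
rewrite mulNr mulrC in h2; lra.
Qed.

(** The discs of radius 2 s about the points of X account for all members of A
    and B at distance at least 4 eta from V, and each contains equally many of
    both. *)
Definition shared_discs V (eta : R) A B X (s : R) :=
  [/\ uniq X, spread X (5 * s),
   forall x, x \in X ->
     count (fun b => nm (b - x) < 2 * s) B = count (fun a => nm (a - x) < 2 * s) A,
   forall b, b \in A ++ B -> far V (4 * eta) b ->
     exists2 x, x \in X & nm (b - x) < 2 * s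
   & forall x a, x \in X -> nm (a - x) < 2 * s -> far V eta a].

Lemma far_near V x a (e d : R) : far V e x -> nm (a - x) <= d -> far V (e - d) a.
Proof.
move=> fx ax v /fx xv; have := ler_nm_dist x a v; rewrite (nmBC x a); lra.
Qed.

(** The centres are those of the clusters of the far roots, restricted to the
    centres at distance at least 3 eta from V, so that [half_plane] applies
    around them.  The margins between eta and 4 eta leave room for the radii of
    the discs. *)
Lemma derivative_shared_discs V (eta r s0 : R) (M : nat) :
  closed V -> real_convex V -> 0 < eta -> 0 < s0 -> s0 <= eta / 4 ->
  exists N, forall p, (N < size p)%N ->
    (forall a, a \in proots p -> nm a <= r) ->
    (count (fun a => `[< far V eta a >]) (proots p) <= M)%N ->
  exists X, exists2 s, s <= s0 & shared_discs V eta (proots p) (proots p^`()) X s.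
Proof.
move=> cV coV eta0 s00 s0eta.
(* Clusters started at radius s1 end with a radius at most s0, since there are
   at most M far roots; N depends on s1 and not on the final radius. *)
pose s1 := s0 / 6 ^+ M.
have s10 : 0 < s1 by rewrite divr_gt0 // exprn_gt0.
pose kappa := eta / (2 * r + eta) ^+ 2.
pose n0 := Num.truncn ((1 + M%:R / s1) / kappa).
exists (n0 + M).+2 => p szp pr pM.
have p0 : p != 0 by rewrite -size_poly_gt0; case: (size p) szp.
have szr := size_proots p0.
have p'0 : p^`() != 0.
  by rewrite -size_poly_gt0 size_deriv_C; move: szp; case: (size p) => [|[]].
have r0 : 0 <= r.
  case: (proots p) szr pr => [|a l _ pr]; last exact: le_trans (nm_ge0 a) (pr _ (mem_head _ _)).
  by move: szp; case: (size p) => [|[]].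
have p'r := gauss_lucas_disc p'0 pr.
have k0 : 0 < kappa by rewrite divr_gt0 // exprn_gt0 //; lra.
have big s : s1 <= s -> 1 + M%:R / s <=
    (size (proots p) - M)%:R * (eta / (2 * r + eta) ^+ 2).
  move=> s1s; rewrite -/kappa; apply: (@le_trans _ _ (1 + M%:R / s1)).
    by rewrite lerD2l ler_wpM2l // lef_pV2 // posrE; lra.
  rewrite -ler_pdivrMr //; apply: (@le_trans _ _ n0.+1%:R).
    by apply/ltW/truncnS_gt.
  by rewrite ler_nat szr; move: szp; lia.
pose A := [seq a <- proots p | `[< far V eta a >]].
have szA : (size A <= M)%N by rewrite size_filter.
have [X [s [uX XA /andP[s1s sle] sepX covX]]] := exists_clusters A s10.
have s0' : 0 < s by exact: lt_le_trans s1s.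
have {sle} ss0 : s <= s0.
  apply: le_trans sle _; rewrite /s1 mulrCA ger_pMr // ler_pdivrMr ?exprn_gt0 //.
  by rewrite mul1r ler_weXn2l // ler1n.
clear szp n0 k0 kappa; clearbody s1.
pose Y := [seq x <- X | `[< far V (3 * eta) x >]].
have YX : {subset Y <= X} by move=> x; rewrite mem_filter => /andP[].
have Xr x : x \in X -> nm x <= r.
  by move=> /XA; rewrite mem_filter => /andP[_ /pr].
have Yfar x : x \in Y -> far V (3 * eta) x.
  by rewrite mem_filter => /andP[/asboolP].
exists Y, s => //; split.
- exact: filter_uniq.
- by move=> x y /YX xX /YX yX; exact: sepX.
- (* The circle of radius 2 s about x avoids all clusters by at least s. *)
  move=> x xY; have fx := Yfar x xY; have xX := YX _ xY.
  have [u hu] := log_derivative_half_plane cV coV eta0 s0' fx (Xr _ xX) pr pM (big _ s1s).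
  apply: (@count_disc_affine _ (u * (lead_coef p^`() / lead_coef p)) x (2 * s)
     (proots p) (proots p^`()) 1) => //; first by rewrite mulr_gt0.
  move=> z zx; have [||zp] := hu z; first by rewrite zx; lra.
    move=> a ap fa; have [y yX ay] : exists2 y, y \in X & nm (a - y) <= s.
      by apply: covX; rewrite mem_filter ap andbT; apply/asboolP.
    have [yx|yx] := eqVneq y x.
      by have := ler_nm_dist z a x; rewrite zx; rewrite yx in ay; lra.
    have := sepX _ _ yX xX yx; have := ler_nm_dist y a x.
    by have := ler_nm_dist a z x; rewrite zx (nmBC y a) (nmBC a z); lra.
  congr (_ <= re _); rewrite -mulrA; congr (_ * _).
  have pz0 : p.[z] != 0 by apply: contra zp; rewrite -root_proots.
  apply: (mulfI pz0); rewrite -horner_deriv_proots // [in LHS]horner_proots.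
  move: pz0; rewrite horner_proots mulf_eq0 negb_or => /andP[l0 P0].
  by field; rewrite l0 P0.
- move=> b; rewrite mem_cat => bpp fb4.
  have fb e : e <= 4 * eta -> far V e b by move=> ee v /fb4; exact: le_trans.
  have inY x : x \in X -> nm (b - x) <= eta -> x \in Y.
    move=> xX bx; rewrite mem_filter xX andbT; apply/asboolP.
    have -> : 3 * eta = 4 * eta - eta by ring.
    by apply: far_near fb4 _; rewrite nmBC.
  have [bp|bNp] := boolP (b \in proots p).
    have [x xX bx] : exists2 x, x \in X & nm (b - x) <= s.
      by apply: covX; rewrite mem_filter bp andbT; apply/asboolP/fb; lra.
    by exists x; [apply: inY => //; lra | lra].
  have bp' : b \in proots p^`() by move: bpp; rewrite (negbTE bNp).
  have [//|nex] := pselect (exists2 x, x \in Y & nm (b - x) < 2 * s).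
  (* Outside all discs b is at distance s from the far roots, so the
     logarithmic derivative cannot vanish at b. *)
  have f3b : far V (3 * eta) b by apply: fb; lra.
  have [u hu] := log_derivative_half_plane cV coV eta0 s0' f3b (p'r _ bp') pr pM (big _ s1s).
  have [||_] := hu b; first by rewrite subrr nm0; lra.
    move=> a ap fa; have [y yX ay] : exists2 y, y \in X & nm (a - y) <= s.
      by apply: covX; rewrite mem_filter ap andbT; apply/asboolP.
    have [byeta|byeta] := leP (nm (b - y)) eta; last first.
      by have := ler_nm_dist b a y; lra.
    have [bys|bys] := ltP (nm (b - y)) (2 * s).
      by case: nex; exists y => //; exact: inY.
    by have := ler_nm_dist b a y; lra.
  have := bp'; rewrite -root_proots // => /rootP; rewrite horner_deriv_proots //.
  move=> /eqP; rewrite mulf_eq0 => /orP[|/eqP ->]; last by rewrite mulr0 re0; lra.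
  by rewrite -rootE root_proots // (negbTE bNp).
- move=> x a /Yfar fx ax; have h : far V (3 * eta - 2 * s) a.
    by apply: far_near fx _; exact: ltW.
  by move=> v /h; apply: le_trans; lra.
Qed.

Lemma disc_count_le1 X (s : R) a : uniq X -> spread X (5 * s) ->
  (count (fun x => (nm (a - x) < 2 * s)%R) X <= 1)%N.
Proof.
move=> uX sepX; rewrite -size_filter; set Y := [seq x <- X | nm (a - x) < 2 * s].
have uY : uniq Y by exact: filter_uniq.
have YX x : x \in Y -> x \in X /\ nm (a - x) < 2 * s.
  by rewrite mem_filter => /andP[].
case: Y uY YX => [//|x [//|y Y]] /= /andP[+ _] YX; rewrite inE negb_or => /andP[xy _].
have [xX ax] := YX x (mem_head _ _).
have [yX ay] : y \in X /\ nm (a - y) < 2 * s by apply: YX; rewrite !inE eqxx orbT.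
have := sepX _ _ xX yX xy; have := ler_nm_dist x a y; rewrite (nmBC x a).
have := nm_ge0 (a - x); lra.
Qed.

Lemma sum_over_discs (G : nmodType) (F : C -> G) X B (s : R) :
  uniq X -> spread X (5 * s) ->
  (forall b, b \in B -> F b != 0 -> exists2 x, x \in X & nm (b - x) < 2 * s) ->
  \sum_(b <- B) F b = \sum_(x <- X) \sum_(b <- B | nm (b - x) < 2 * s) F b.
Proof.
move=> uX sepX cov; under [RHS]eq_bigr do rewrite big_mkcond.
rewrite exchange_big /=; apply: eq_big_seq => b bB.
rewrite -big_mkcond /= big_const_seq iter_addr_0.
have [->|Fb0] := eqVneq (F b) 0; first by rewrite mul0rn.
have [x xX bx] := cov b bB Fb0.
suff -> : count (fun x => nm (b - x) < 2 * s) X = 1%N by rewrite mulr1n.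
apply/eqP; rewrite eqn_leq disc_count_le1 //= -has_count; apply/hasP.
by exists x.
Qed.

Section SharedDiscs.
Variables (V : set C) (eta : R) (A B X : seq C) (s : R) (M : nat).
Hypothesis sd : shared_discs V eta A B X s.
Hypothesis AM : (count (fun a => `[< far V eta a >]) A <= M)%N.

Lemma shared_discs_count :
  (\sum_(x <- X) count (fun a => nm (a - x) < 2 * s)%R A <= M)%N.
Proof.
have [uX sepX _ _ Xfar] := sd; apply: leq_trans AM.
rewrite -[X in (_ <= X)%N]sum1_count [X in (_ <= X)%N]big_mkcond /=.
under eq_bigr do rewrite -sum1_count big_mkcond.
rewrite exchange_big /=; apply: leq_sum => a _; rewrite -big_mkcond sum1_count.
have := disc_count_le1 a uX sepX; case: asboolP => //= nf _.
rewrite leqn0 -leqn0 leqNgt -has_count; apply/hasPn => x xX.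
by apply/negP => /(Xfar _ _ xX).
Qed.

Lemma shared_discs_far : (count (fun b => `[< far V (4 * eta) b >]) B <= M)%N.
Proof.
have [uX sepX cnt cov _] := sd; apply: leq_trans shared_discs_count.
rewrite -sum1_count big_mkcond (sum_over_discs uX sepX).
  rewrite big_seq [X in (_ <= X)%N]big_seq; apply: leq_sum => x xX.
  rewrite -cnt // -sum1_count; apply: leq_sum => b _; by case: ifP.
move=> b bB; case: asboolP => // fb _; apply: cov => //.
by rewrite mem_cat bB orbT.
Qed.

(** In each disc, replacing phi by its value at the centre costs at most e per
    root, and the constants cancel because the counts agree. *)
Lemma shared_discs_sum (phi : C -> C) (e : R) : 0 <= e ->
  (forall z, phi z != 0 -> far V (4 * eta) z) ->
  (forall z w, nm (z - w) < 2 * s -> nm (phi z - phi w) <= e) ->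
  nm (\sum_(b <- B) phi b - \sum_(a <- A) phi a) <= 2 * e * M%:R.
Proof.
move=> e0 supp osc; have [uX sepX cnt cov _] := sd.
have supp' (D : seq C) : (forall d, d \in D -> d \in A ++ B) ->
    forall d, d \in D -> phi d != 0 -> exists2 x, x \in X & nm (d - x) < 2 * s.
  by move=> DAB d dD pd; apply: cov; [exact: DAB|exact: supp].
rewrite (sum_over_discs uX sepX (supp' B _)); last first.
  by move=> b bB; rewrite mem_cat bB orbT.
rewrite (sum_over_discs uX sepX (supp' A _)); last first.
  by move=> a aA; rewrite mem_cat aA.
have center (D : seq C) x : \sum_(d <- D | nm (d - x) < 2 * s) phi d =
    \sum_(d <- D | nm (d - x) < 2 * s) (phi d - phi x)
      + phi x *+ count (fun d => nm (d - x) < 2 * s) D.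
  rewrite sumrB big_const_seq iter_addr_0 subrK //.
have bound (D : seq C) x : nm (\sum_(d <- D | nm (d - x) < 2 * s) (phi d - phi x))
    <= e * (count (fun d => nm (d - x) < 2 * s) D)%:R.
  apply: le_trans (ler_nm_sum _ _ _) _.
  rewrite -sum1_count natr_sum mulr_sumr; apply: ler_sum => d dx.
  by rewrite mulr1; exact: osc.
rewrite -sumrB; apply: le_trans (ler_nm_sum _ _ _) _.
apply: (@le_trans _ _ (\sum_(x <- X)
    2 * e * (count (fun a => nm (a - x) < 2 * s) A)%:R)).
  rewrite big_seq [leRHS]big_seq; apply: ler_sum => x xX.
  rewrite !center cnt // opprD addrACA subrr addr0.
  apply: le_trans (ler_nmD _ _) _; rewrite nmN.
  have := bound B x; have := bound A x; rewrite cnt //; lra.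
rewrite -mulr_sumr -natr_sum.
by rewrite ler_wpM2l ?mulr_ge0 // ler_nat shared_discs_count.
Qed.

End SharedDiscs.
End Clusters.
(** * Divisors and measures of polynomials as sums over their roots *)

Section DivisorsOfPolynomials.
Variable R : realType.
Local Notation C := (Cplx R).
Implicit Types (z : C) (p : {poly C}) (phi : C -> C).

Lemma mup_proots p z : p != 0 -> mup z p = count_mem z (proots p).
Proof.
move=> p0; set s := proots p.
rewrite {1}(prootsE p) -mul_polyC mupMr; last by rewrite rootC lead_coef_eq0.
rewrite (bigID (pred1 z)) /= mupMl; last first.
  rewrite -big_filter root_prod_XsubC mem_filter /= eqxx //.
rewrite (eq_bigr (fun=> 'X - z%:P)); last by move=> a /eqP ->.
by rewrite big_const_seq -Monoid.iteropE -[iterop _ _ _ _]/(_ ^+ _) mup_XsubCX eqxx.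
Qed.

Lemma div_act_zero_div U p phi : p != 0 -> (forall z, phi z != 0 -> U z) ->
  div_act (zero_div U p) phi = \sum_(a <- proots p) phi a.
Proof.
move=> p0 supp; rewrite /div_act.
rewrite (fsbig_widen _ setT) //; last first.
  move=> z [_ Uz] /=; have [->|/supp //] := eqVneq (phi z) 0.
  by rewrite mulr0.
rewrite (@fsbigE _ _ _ _ _ (undup (proots p))) ?undup_uniq //; last first.
  move=> z _; rewrite mem_undup -root_proots // => /mupNroot /= ->.
  by rewrite mul0r.
rewrite -[RHS]big_undup_iterop_count.
apply: eq_big => [z|z _]; first by rewrite in_setT.
by rewrite /= mup_proots // -[iterop _ _ _ _]/(_ *+ _) -mulr_natl pmulrn.
Qed.

Lemma root_countE p (K : set C) : p != 0 ->
  root_count p K = ((count (fun a => `[< K a >]) (proots p))%:R)%:E.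
Proof.
move=> p0.
have -> : root_count p K = (\sum_(j < deg p) \d_((proots p)`_j : Cborel R) K)%E.
  by [].
under eq_bigr do rewrite diracE.
rewrite sumEFin; congr EFin; rewrite /deg -size_proots //.
rewrite -natr_sum; congr _%:R.
rewrite -sum1_count (big_nth 0) big_mkord [RHS]big_mkcond /=.
apply: eq_bigr => i _; rewrite -[_ \in K]/(`[< K _ >]).
by case: asboolP.
Qed.

Lemma root_dist_disc p (r : R) : p != 0 -> (0 < deg p)%N ->
  root_dist p (open_disc r) = 1%E -> forall a, a \in proots p -> nm a <= r.
Proof.
move=> p0 dp; rewrite /root_dist /= /mscale /= root_countE // => h a ap.
have d0 : (deg p)%:R != 0 :> R by rewrite pnatr_eq0 -lt0n.
move: h => /(congr1 fine) /= /(congr1 ( *%R (deg p)%:R)).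
rewrite mulrA divff // mul1r mulr1 => /eqP; rewrite eqr_nat /deg -size_proots //.
rewrite -all_count => /allP /(_ a ap) /asboolP.
by rewrite /open_disc /= nmE /rc ltcR => /ltW.
Qed.

End DivisorsOfPolynomials.

(** * Sequences of polynomials *)

Section Sequences.
Variable R : realType.
Local Notation C := (Cplx R).
Implicit Types (V U : set C) (phi : C -> C).

(** The hypotheses of the theorem in a form that is inherited by derivatives:
    they hold only eventually, they allow any leading coefficient, and
    sparseness is tested on the closed sets [far V eta]. *)
Definition sparse_off V (r : R) (q : nat -> {poly C}) :=
  [/\ forall N, \forall k \near \oo, (N < size (q k))%N,
      \forall k \near \oo, forall a, a \in proots (q k) -> nm a <= r
    & forall eta, 0 < eta -> exists M : nat, \forall k \near \oo,
        (count (fun a => `[< far V eta a >]) (proots (q k)) <= M)%N].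

Lemma near_shared_discs V r q (eta s0 : R) : closed V -> real_convex V ->
  sparse_off V r q -> 0 < eta -> 0 < s0 -> s0 <= eta / 4 ->
  exists M : nat, \forall k \near \oo, exists X, exists2 s, s <= s0 &
    shared_discs V eta (proots (q k)) (proots (q k)^`()) X s /\
    (count (fun a => `[< far V eta a >]) (proots (q k)) <= M)%N.
Proof.
move=> cV coV [qinf qr qsp] eta0 s00 s0eta.
have [M qM] := qsp eta eta0.
have [N hN] := derivative_shared_discs r M cV coV eta0 s00 s0eta.
exists M; near=> k.
have szk : (N < size (q k))%N by near: k; exact: qinf.
have rk : forall a, a \in proots (q k) -> nm a <= r by near: k.
have Mk : (count (fun a => `[< far V eta a >]) (proots (q k)) <= M)%N by near: k.
have [X [s ss0 sd]] := hN (q k) szk rk Mk.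
by exists X, s.
Unshelve. all: by end_near. Qed.

(** The far roots of the derivative lie in discs that hold at most as many roots
    as the polynomial has far roots, for a smaller eta. *)
Lemma sparse_off_deriv V r q : closed V -> real_convex V ->
  sparse_off V r q -> sparse_off V r (fun k => (q k)^`()).
Proof.
move=> cV coV sq; have [qinf qr qsp] := sq; split.
- move=> N; near=> k; rewrite size_deriv_C.
  have : (N.+1 < size (q k))%N by near: k; exact: qinf.
  by case: (size _).
- near=> k; apply: gauss_lucas_disc.
    rewrite -size_poly_gt0 size_deriv_C.
    have : (1 < size (q k))%N by near: k; exact: qinf.
    by case: (size _) => [|[]].
  by near: k.
- move=> eta eta0.
  have eta4 : 0 < eta / 4 by lra.
  have eta16 : 0 < eta / 4 / 4 by lra.
  have [M hM] := near_shared_discs cV coV sq eta4 eta16 (lexx _).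
  exists M; near=> k.
  have [X [s _ [sd Mk]]] : exists X, exists2 s, s <= eta / 4 / 4 &
      shared_discs V (eta / 4) (proots (q k)) (proots (q k)^`()) X s /\
      (count (fun a => `[< far V (eta / 4) a >]) (proots (q k)) <= M)%N by near: k.
  have := shared_discs_far sd Mk.
  by have -> : 4 * (eta / 4) = eta by lra.
Unshelve. all: by end_near. Qed.

(** The discs can be made so small that phi oscillates by less than e1 on each;
    the bound M on the number of roots involved does not depend on their
    radius. *)
Lemma root_sum_deriv_near V r q phi (eta e : R) : closed V -> real_convex V ->
  sparse_off V r q -> 0 < eta -> (forall z, phi z != 0 -> far V eta z) ->
  (forall e, 0 < e -> exists2 d : R, 0 < d &
     forall z w, nm (z - w) < d -> nm (phi z - phi w) < e) ->
  0 < e -> \forall k \near \oo,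
    nm (\sum_(b <- proots (q k)^`()) phi b - \sum_(a <- proots (q k)) phi a) < e.
Proof.
move=> cV coV sq eta0 supp ucont e0.
have eta4 : 0 < eta / 4 by lra.
have eta16 : 0 < eta / 4 / 4 by lra.
have [_ _ /(_ _ eta4)[M qM]] := sq.
pose e1 := e / (2 * M%:R + 1).
have D0 : 0 < 2 * M%:R + 1 :> R by rewrite ltr_wpDl.
have e10 : 0 < e1 by rewrite divr_gt0.
have [d d0 dphi] := ucont e1 e10.
pose s0 := Num.min (d / 2) (eta / 4 / 4).
have s00 : 0 < s0 by rewrite lt_min eta16 andbT; lra.
have s0le : s0 <= eta / 4 / 4 by rewrite ge_min lexx orbT.
have s0d : s0 <= d / 2 by rewrite ge_min lexx.
have [M' hM] := near_shared_discs cV coV sq eta4 s00 s0le.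
near=> k.
have [X [s ss0 [sd _]]] : exists X, exists2 s, s <= s0 &
    shared_discs V (eta / 4) (proots (q k)) (proots (q k)^`()) X s /\
    (count (fun a => `[< far V (eta / 4) a >]) (proots (q k)) <= M')%N by near: k.
have Mk : (count (fun a => `[< far V (eta / 4) a >]) (proots (q k)) <= M)%N by near: k.
apply: le_lt_trans (shared_discs_sum sd Mk (ltW e10) _ _) _.
- by have -> : 4 * (eta / 4) = eta by lra.
- by move=> z w zw; apply/ltW/dphi; lra.
- have h : e1 * (2 * M%:R + 1) = e by rewrite /e1 divfK // gt_eqF.
  by rewrite -h; lra.
Unshelve. all: by end_near. Qed.

Lemma root_sum_derivn_near V r q phi (eta : R) : closed V -> real_convex V ->
  sparse_off V r q -> 0 < eta -> (forall z, phi z != 0 -> far V eta z) ->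
  (forall e, 0 < e -> exists2 d : R, 0 < d &
     forall z w, nm (z - w) < d -> nm (phi z - phi w) < e) ->
  forall m e, 0 < e -> \forall k \near \oo,
    nm (\sum_(b <- proots (q k)^`(m)) phi b - \sum_(a <- proots (q k)) phi a) < e.
Proof.
move=> cV coV sq eta0 supp ucont m.
have [//] : sparse_off V r (fun k => (q k)^`(m)) /\ forall e, 0 < e ->
  \forall k \near \oo, nm (\sum_(b <- proots (q k)^`(m)) phi b
                         - \sum_(a <- proots (q k)) phi a) < e.
elim: m => [|m [sqm ih]].
  by split=> // e e0; near=> k; rewrite derivn0 subrr nm0.
split.
  have := sparse_off_deriv cV coV sqm.
  by congr sparse_off; apply/funext => k; rewrite derivnS.
move=> e e0; have e2 : 0 < e / 2 by lra.
have h := root_sum_deriv_near cV coV sqm eta0 supp ucont e2.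
near=> k; rewrite derivnS.
have h1 : nm (\sum_(b <- proots (q k)^`(m)^`()) phi b
  - \sum_(a <- proots (q k)^`(m)) phi a) < e / 2 by near: k.
have h2 : nm (\sum_(b <- proots (q k)^`(m)) phi b
  - \sum_(a <- proots (q k)) phi a) < e / 2 by near: k; exact: ih.
apply: le_lt_trans (ler_nm_dist _ (\sum_(a <- proots (q k)^`(m)) phi a) _) _; lra.
Unshelve. all: by end_near. Qed.

End Sequences.

Theorem corollary1 (R : realType) (q : nat -> {poly (Cplx R)})
    (U : set (Cplx R))
    (q_monic : forall k, q k \is monic)
    (deg_gt0 : forall k, (0 < deg (q k))%N)
    (deg_cvg : (fun k => deg (q k)) @ \oo --> \oo)
    (bounded_roots : exists r : R, 0 < r /\
       forall k, root_dist (q k) (open_disc r) = 1%E)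
    (U_sparse : root_sparse q U)
    (V_convex : convex_Cplx (~` U)) :
  forall (m : nat) (phi : Cplx R -> Cplx R), Cc U phi ->
    (fun k => div_act (zero_div U (q k)^`(m)) phi
              - div_act (zero_div U (q k)) phi) @ \oo --> (0 : Cplx R).
Proof.
move=> m phi [cphi cptphi subU].
have [oU sparseU] := U_sparse.
have [r [r0 qr]] := bounded_roots.
have cV : closed (~` U) by exact: open_closedC.
have coV := convex_Cplx_real_convex V_convex.
have q0 k : q k != 0 by exact: monic_neq0.
have qinf N : \forall k \near \oo, (N < size (q k))%N.
  have /cvgnyPge/(_ N) := deg_cvg; apply: filterS => k.
  by have := q0 k; rewrite -size_poly_gt0 /deg; case: (size _).
have sq : sparse_off (~` U) r q.
  split=> //; first by near=> k; exact: (root_dist_disc (q0 k) (deg_gt0 k) (qr k)).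
  move=> eta eta0.
  (* All roots lie in the disc of radius r, so the far roots are those in the
     compact set T. *)
  pose T := [set z : Cplx R | nm z <= r] `&` far (~` U) eta.
  have cT : compact T.
    apply: (@closed_bounded_compact _ _ r); last by move=> z [].
    apply: closedI (@closed_far _ _ _); exact: compact_closed (@norm_hausdorff _ _) (@compact_disc R r).
  have TU : T `<=` U.
    move=> z [_ /(_ z) fz]; apply: contrapT => /fz.
    by rewrite subrr nm0; lra.
  have [M hM] := sparseU T cT TU.
  exists (Num.truncn M).+1; near=> k.
  have : (root_count (q k) T <= M%:E)%E by near: k.
  rewrite root_countE // lee_fin => cM; rewrite -ltnS.
  have -> : count (fun a => `[< far (~` U) eta a >]) (proots (q k)) =
            count (fun a => `[< T a >]) (proots (q k)).
    apply: eq_in_count => a ap; apply/asbool_equiv_eq; split=> [fa|[]//].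
    by split=> //; exact: (root_dist_disc (q0 k) (deg_gt0 k) (qr k) ap).
  rewrite -(ltr_nat R); apply: le_lt_trans cM _.
  by apply: lt_trans (truncnS_gt _) _; rewrite ltr_nat.
have supp z : phi z != 0 -> closure [set z | phi z != 0] z.
  by move=> pz; apply: subset_closure.
have [eta eta0 Kfar] := compact_far oU cptphi subU.
have ucont e : 0 < e -> exists2 d : R, 0 < d &
    forall z w, nm (z - w) < d -> nm (phi z - phi w) < e.
  move=> e0; have [d d0 hd] := uniform_continuity cphi cptphi e0.
  exists d => // z w zw.
  have [pz|/supp Kz] := eqVneq (phi z) 0; last exact: hd.
  have [pw|/supp Kw] := eqVneq (phi w) 0; first by rewrite pz pw subrr nm0.
  by rewrite nmBC; apply: hd => //; rewrite nmBC.
have main := root_sum_derivn_near cV coV sq eta0 (fun z pz => Kfar z (supp z pz)) ucont m.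
move=> P /nbhs_nmP[e e0 eP].
suff : \forall k \near \oo, nm (div_act (zero_div U (q k)^`(m)) phi
    - div_act (zero_div U (q k)) phi) < e.
  by apply: filterS => k h; apply: eP; rewrite sub0r nmN.
have suppU z : phi z != 0 -> U z by move=> /supp /subU.
have main_e := main e e0.
near=> k.
have qm0 : (q k)^`(m) != 0.
  by rewrite -size_poly_gt0 size_derivn_C subn_gt0; near: k; exact: qinf.
by rewrite !div_act_zero_div //; near: k.
Unshelve. all: by end_near. Qed.
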